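(* Let $p$ be an odd prime and let $\mathcal{G}$ be the GGS-group with constant defining vector $(1,\dots,1)\in\mathbb{F}_p^{p-1}$. Then the congruence kernel of $\mathcal{G}$ is infinite.
   Context: Fix an odd prime $p$. Let $X=\{1,\dots,p\}$ and let $T$ be the regular rooted tree whose vertices are the words in the free monoid $X^*$, with $u,v$ joined by an edge if $v=ux$ or $u=vx$ for some $x\in X$. $L_n$ is the set of words of length $n$. $\operatorname{Aut} T$ is the group of automorphisms of $T$ and $\operatorname{st}(n)$ is the stabilizer of all vertices of $L_n$; for $G\le \operatorname{Aut}T$, $\operatorname{st}_G(n)=G\cap\operatorname{st}(n)$. For $g$ fixing a vertex $v$, $g_v\in\operatorname{Aut}T$ denotes the restriction of $g$ to the subtree rooted at $v$ (identified with $T$), i.e. $g(vw)=v\,g_v(w)$; $\psi:\operatorname{st}(1)\to \operatorname{Aut}T\times\overset{p}{\cdots}\times\operatorname{Aut}T$ is the isomorphism $g\mapsto(g_1,\dots,g_p)$. The GGS-group with constant defining vector is $\mathcal{G}=\langle a,b\rangle\le\operatorname{Aut}T$, where $a$ is the rooted automorphism given by $a(xv)=\sigma(x)v$ for $x\in X$, $v\in X^*$, with $\sigma=(1\;2\;\dots\;p)$, and $b\in\operatorname{st}(1)$ is recursively defined by $\psi(b)=(a,a,\dots,a,b)$. For $G\le\operatorname{Aut}T$, the congruence completion $\overline{G}$ is the completion of $G$ with respect to the subgroups $\{\operatorname{st}_G(n)\mid n\in\mathbb{N}\}$, i.e. $\overline{G}=\varprojlim_n G/\operatorname{st}_G(n)$.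 The profinite completion $\widehat{G}$ maps naturally onto $\overline{G}$, and the kernel of $\widehat{G}\to\overline{G}$ is the congruence kernel of $G$. *)

(* Defs.v *)
From HB Require Import structures.
From mathcomp Require Import all_boot.
From mathcomp Require Import boolp classical_sets functions cardinality.

Set Implicit Arguments.
Unset Strict Implicit.
Unset Printing Implicit Defensive.

Local Open Scope classical_set_scope.
Local Open Scope quotient_scope.
Local Open Scope group_scope.

Record normalSubgroup (G : groupType) := NormalSubgroup {
  nsg_set :> G -> Prop;
  nsg1 : nsg_set 1;
  nsgF : forall x y, nsg_set x -> nsg_set y -> nsg_set (x / y);
  nsgJ : forall x y, nsg_set x -> nsg_set (x ^ y) }.

Section Quotient.
Variables (G : groupType) (N : normalSubgroup G).

Lemma nsgV x : N x -> N x^-1.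
Proof. by move=> Nx; rewrite -(mul1g x^-1); apply: nsgF => //; exact: nsg1. Qed.

Lemma nsgM x y : N x -> N y -> N (x * y).
Proof. by move=> Nx Ny; rewrite -(invgK y); apply: nsgF => //; exact: nsgV. Qed.

Definition coset_eq : rel G := fun x y => `[< N (x^-1 * y) >].

Lemma coset_eq_refl : reflexive coset_eq.
Proof. by move=> x; apply/asboolP; rewrite mulVg; exact: nsg1. Qed.

Lemma coset_eq_sym : symmetric coset_eq.
Proof.
by move=> x y; apply/asboolP/asboolP => /nsgV; rewrite invgM invgK.
Qed.

Lemma coset_eq_trans : transitive coset_eq.
Proof.
move=> y x z /asboolP xy /asboolP yz; apply/asboolP.
by have := nsgM xy yz; rewrite -mulgA (mulgA y) mulgV mul1g.
Qed.

Canonical coset_equiv :=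
  EquivRel coset_eq coset_eq_refl coset_eq_sym coset_eq_trans.

Definition quot := {eq_quot coset_equiv}%qT.
HB.instance Definition _ := Choice.on quot.
HB.instance Definition _ := EqQuotient.on quot.

Lemma quotP x y : \pi_quot x = \pi_quot y <-> N (x^-1 * y).
Proof. by split=> [/eqquotP/asboolP|h] //; apply/eqquotP/asboolP. Qed.

Lemma quot_ind (P : quot -> Prop) :
  (forall g, P (\pi_quot g)) -> forall x, P x.
Proof. by move=> Ppi x; rewrite -[x]reprK. Qed.

Definition quot_mul (x y : quot) : quot := \pi_quot (repr x * repr y).
Definition quot_one : quot := \pi_quot 1.
Definition quot_inv (x : quot) : quot := \pi_quot (repr x)^-1.

Lemma quot_repr x : N (x^-1 * repr (\pi_quot x)).
Proof. by apply/quotP; rewrite reprK. Qed.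

Lemma pi_mulE x y : quot_mul (\pi_quot x) (\pi_quot y) = \pi_quot (x * y).
Proof.
apply/esym/quotP; have Nx := quot_repr x; have Ny := quot_repr y.
set x' := repr _ in Nx *; set y' := repr _ in Ny *.
suff -> : (x * y)^-1 * (x' * y') = (x^-1 * x') ^ y * (y^-1 * y').
  by apply: nsgM => //; exact: nsgJ.
by rewrite conjgE invgM !mulgA mulgK.
Qed.

Lemma pi_invE x : quot_inv (\pi_quot x) = \pi_quot x^-1.
Proof.
apply/quotP; have /nsgV Nx := quot_repr x; set x' := repr _ in Nx *.
by have := nsgJ x^-1 (nsgV Nx); rewrite conjgE !invgK !mulgA mulgV mul1g.
Qed.

Lemma quot_mulgA : associative quot_mul.
Proof.
move=> x y z; elim/quot_ind: x => x; elim/quot_ind: y => y; elim/quot_ind: z => z.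
by rewrite !pi_mulE mulgA.
Qed.

Lemma quot_mul1g : left_id quot_one quot_mul.
Proof. by move=> x; elim/quot_ind: x => x; rewrite pi_mulE mul1g. Qed.

Lemma quot_mulg1 : right_id quot_one quot_mul.
Proof. by move=> x; elim/quot_ind: x => x; rewrite pi_mulE mulg1. Qed.

Lemma quot_mulVg : left_inverse quot_one quot_inv quot_mul.
Proof. by move=> x; elim/quot_ind: x => x; rewrite pi_invE pi_mulE mulVg. Qed.

Lemma quot_mulgV : right_inverse quot_one quot_inv quot_mul.
Proof. by move=> x; elim/quot_ind: x => x; rewrite pi_invE pi_mulE mulgV. Qed.

HB.instance Definition _ := isGroup.Build quot
  quot_mulgA quot_mul1g quot_mulg1 quot_mulVg quot_mulgV.

Lemma quot_piM x y : \pi_quot (x * y) = \pi_quot x * \pi_quot y.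
Proof. by rewrite [RHS]pi_mulE. Qed.

Lemma quot_pi1 : \pi_quot 1 = 1. Proof. by []. Qed.

Lemma quot_piV x : \pi_quot x^-1 = (\pi_quot x)^-1.
Proof. by rewrite [RHS]pi_invE. Qed.

Definition finite_index := finite_set [set: quot].

End Quotient.

(* The transition map G/N -> G/M, gN |-> gM; meaningful when N is contained
   in M (see quot_mapE). *)
Definition quot_map (G : groupType) (N M : normalSubgroup G) (x : quot N) :
  quot M := \pi_(quot M) (repr x).

Lemma quot_mapE (G : groupType) (N M : normalSubgroup G) (g : G) :
  N `<=` M -> quot_map M (\pi_(quot N) g) = \pi_(quot M) g.
Proof. by move=> NM; apply/esym/quotP/NM/quot_repr. Qed.

Section Completion.
Variables (G : groupType) (I : Type) (N : I -> normalSubgroup G).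

(* The inverse limit of the groups G / N i, ordered by reverse inclusion of
   the N i. *)
Definition compatible (x : forall i, quot (N i)) :=
  forall i j, N i `<=` N j -> quot_map (N j) (x i) = x j.

Record completion := Completion {
  coord :> forall i, quot (N i);
  coordP : compatible coord }.

Lemma completionP (x y : completion) : (forall i, x i = y i) -> x = y.
Proof.
case: x y => [x xP] [y yP] /= xy.
have {}xy : x = y by apply: functional_extensionality_dep.
by rewrite xy in xP *; congr Completion; exact: Prop_irrelevance.
Qed.

HB.instance Definition _ := gen_eqMixin completion.
HB.instance Definition _ := gen_choiceMixin completion.

Lemma quot_mapM i j (x y : quot (N i)) : N i `<=` N j ->
  quot_map (N j) (x * y) = quot_map (N j) x * quot_map (N j) y.
Proof.
by elim/quot_ind: x => x; elim/quot_ind: y => y le; rewrite -quot_piM !quot_mapE // quot_piM.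
Qed.

Lemma compatible_mul (x y : completion) : compatible (fun i => x i * y i).
Proof. by move=> i j ij; rewrite quot_mapM // !coordP. Qed.

Lemma compatible_one : compatible (fun i => 1).
Proof. by move=> i j ij; rewrite -!quot_pi1 quot_mapE. Qed.

Lemma compatible_inv (x : completion) : compatible (fun i => (x i)^-1).
Proof.
move=> i j ij; rewrite -(coordP x ij); elim/quot_ind: (x i) => g.
by rewrite -quot_piV !quot_mapE // quot_piV.
Qed.

Definition completion_mul x y := Completion (compatible_mul x y).
Definition completion_one := Completion compatible_one.
Definition completion_inv x := Completion (compatible_inv x).

Lemma completion_mulgA : associative completion_mul.
Proof. by move=> x y z; apply: completionP => i /=; rewrite mulgA. Qed.

Lemma completion_mul1g : left_id completion_one completion_mul.
Proof. by move=> x; apply: completionP => i /=; rewrite mul1g. Qed.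

Lemma completion_mulg1 : right_id completion_one completion_mul.
Proof. by move=> x; apply: completionP => i /=; rewrite mulg1. Qed.

Lemma completion_mulVg : left_inverse completion_one completion_inv completion_mul.
Proof. by move=> x; apply: completionP => i /=; rewrite mulVg. Qed.

Lemma completion_mulgV : right_inverse completion_one completion_inv completion_mul.
Proof. by move=> x; apply: completionP => i /=; rewrite mulgV. Qed.

HB.instance Definition _ := isGroup.Build completion completion_mulgA
  completion_mul1g completion_mulg1 completion_mulVg completion_mulgV.

End Completion.

Record finiteIndexNormal (G : groupType) := FiniteIndexNormal {
  finsg :> normalSubgroup G;
  finsgP : finite_index finsg }.

Definition profinite_completion (G : groupType) := completion (@finsg G).
HB.instance Definition _ (G : groupType) := Group.on (profinite_completion G).

Section Generated.
Variables (G : groupType) (A : set G).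

Definition generated : {pred G} := fun g =>
  `[< forall S : {pred G}, group_closed S -> (forall x, A x -> x \in S) ->
      g \in S >].

Lemma generated_group_closed : group_closed generated.
Proof.
split=> [|x y /asboolP xA /asboolP yA]; apply/asboolP=> S SG AS; first exact: SG.1.
by apply: SG.2; [exact: xA | exact: yA].
Qed.

Definition gen_group := {g : G | g \in generated}.
HB.instance Definition _ := SubChoice.on gen_group.
HB.instance Definition _ :=
  SubChoice_isSubGroup.Build G generated gen_group generated_group_closed.

End Generated.

(* The alphabet {1, ..., p} is encoded as 'I_p, the letter i being the ordinal
   of value i - 1; vertices of the tree are words. *)
Definition word p := seq 'I_p.

Definition adj p (u v : word p) := exists x, v = rcons u x \/ u = rcons v x.

(* Automorphisms of the tree as a rooted graph; fixing the root is automatic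
   for p >= 2, the root being the only vertex of degree p. *)
Definition tree_aut p (f : word p -> word p) :=
  [/\ bijective f, f [::] = [::] & forall u v, adj (f u) (f v) <-> adj u v].

Record autT p := AutT {
  autT_fun :> word p -> word p;
  autTP : tree_aut autT_fun }.

Section AutT.
Variable p : nat.
Implicit Types (f g h : autT p) (u v : word p).

Lemma autT_eq f g : f =1 g -> f = g.
Proof.
case: f g => [f fP] [g gP] /= /funext fg.
by rewrite fg in fP *; congr AutT; exact: Prop_irrelevance.
Qed.

HB.instance Definition _ := gen_eqMixin (autT p).
HB.instance Definition _ := gen_choiceMixin (autT p).

Lemma tree_aut_id : tree_aut (@id (word p)).
Proof. by split=> //; exists id. Qed.

Lemma tree_aut_comp f g : tree_aut (f \o g).
Proof.
case: f g => [f [fb f0 fa]] [g [gb g0 ga]] /=; split=> [||u v] /=.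
- exact: bij_comp.
- by rewrite g0 f0.
- by rewrite fa ga.
Qed.

Lemma autT_inv_ex f : exists g : word p -> word p, cancel f g /\ cancel g f.
Proof. by case: f => f [[g fg gf] ? ?] /=; exists g. Qed.

Definition autT_inv_fun f : word p -> word p := projT1 (cid (autT_inv_ex f)).

Lemma autT_invK f : cancel f (autT_inv_fun f).
Proof. exact: (projT2 (cid (autT_inv_ex f))).1. Qed.

Lemma autT_invKV f : cancel (autT_inv_fun f) f.
Proof. exact: (projT2 (cid (autT_inv_ex f))).2. Qed.

Lemma tree_aut_inv f : tree_aut (autT_inv_fun f).
Proof.
have fK := autT_invK f; have fVK := autT_invKV f.
case: (autTP f) => _ f0 fa; split=> [||u v].
- by exists f.
- by rewrite -[in LHS]f0 fK.
- by rewrite -fa !fVK.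
Qed.

Definition autT_mul f g := AutT (tree_aut_comp f g).
Definition autT_one := AutT tree_aut_id.
Definition autT_inv f := AutT (tree_aut_inv f).

Lemma autT_mulgA : associative autT_mul.
Proof. by move=> f g h; apply: autT_eq. Qed.

Lemma autT_mul1g : left_id autT_one autT_mul.
Proof. by move=> f; apply: autT_eq. Qed.

Lemma autT_mulg1 : right_id autT_one autT_mul.
Proof. by move=> f; apply: autT_eq. Qed.

Lemma autT_mulVg : left_inverse autT_one autT_inv autT_mul.
Proof. by move=> f; apply: autT_eq; exact: autT_invK. Qed.

Lemma autT_mulgV : right_inverse autT_one autT_inv autT_mul.
Proof. by move=> f; apply: autT_eq; exact: autT_invKV. Qed.

HB.instance Definition _ := isGroup.Build (autT p) autT_mulgA
  autT_mul1g autT_mulg1 autT_mulVg autT_mulgV.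

Lemma autT_mulE f g v : (f * g) v = f (g v). Proof. by []. Qed.

Lemma autT_oneE v : (1 : autT p) v = v. Proof. by []. Qed.

Lemma autT_mulVK f v : f^-1 (f v) = v. Proof. exact: autT_invK. Qed.

Lemma autT_inj f : injective f.
Proof. exact: can_inj (autT_invK f). Qed.

Lemma autT_size f v : size (f v) = size v.
Proof.
have [n] := ubnP (size v); elim: n v => // n IHn v.
case: (autTP f) => _ f0 fa.
case/lastP: v => [|u x] leun; first by rewrite f0.
rewrite size_rcons !ltnS in leun *.
have su := IHn u leun.
have [y [->|fuE]] : adj (f u) (f (rcons u x)) by apply/fa; exists x; left.
  by rewrite size_rcons su.
exfalso; case/lastP: u leun su fuE => [|w z] leun su fuE.
  by move: fuE; rewrite f0; case: (f _).
rewrite size_rcons in leun su.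
have [t [fuE'|fwE]] : adj (f w) (f (rcons w z)) by apply/fa; exists z; left.
  have /rcons_inj[/autT_inj/(congr1 size)] :
    rcons (f (rcons (rcons w z) x)) y = rcons (f w) t by rewrite -fuE.
  by rewrite !size_rcons => /eqP; rewrite -addn2 -[X in _ == X]addn0 eqn_add2l.
move: (IHn w (ltnW leun)) => /eqP.
by rewrite fwE size_rcons su -addn2 -[X in _ == X]addn0 eqn_add2l.
Qed.

Definition st n : set (autT p) := [set g | forall v, size v = n -> g v = v].

End AutT.

Section CongruenceKernel.
Variables (p : nat) (S : {pred autT p}) (G : subGroupType S).

(* G is a subgroup of Aut T, embedded by \val. *)
Definition stG_set n : set G := [set g | st n (\val g)].

Lemma stG_set1 n : stG_set n 1.
Proof. by move=> v _; rewrite val1. Qed.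

Lemma stG_setF n x y : stG_set n x -> stG_set n y -> stG_set n (x / y).
Proof.
move=> xn yn v vn; rewrite gmulfF autT_mulE.
by rewrite -{1}(yn v vn) autT_mulVK xn.
Qed.

Lemma stG_setJ n x y : stG_set n x -> stG_set n (x ^ y).
Proof.
move=> xn v vn; rewrite gmulfJ conjgE !autT_mulE xn ?autT_size //.
exact: autT_mulVK.
Qed.

Definition stG n := NormalSubgroup (@stG_set1 n) (@stG_setF n) (@stG_setJ n).

Lemma stG_finite_index n : finite_index (stG n).
Proof.
have sz (g : G) (t : n.-tuple 'I_p) : size (\val g (val t)) == n.
  by rewrite autT_size size_tuple.
pose F (x : quot (stG n)) := [ffun t => Tuple (sz (repr x) t)].
have Finj : injective F.
  move=> x y /ffunP Fxy; rewrite -[x]reprK -[y]reprK; apply/quotP => v /eqP vn.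
  rewrite gmulfM gmulfV autT_mulE; move: (Fxy (Tuple vn)).
  rewrite !ffunE => /(congr1 val) /= <-; exact: autT_invK.
rewrite /finite_index -(preimage_setT F); apply: finite_preimage.
  exact: in2W.
exact: finite_finset.
Qed.

Definition stG_fin n := FiniteIndexNormal (stG_finite_index n).

Definition congruence_completion := completion stG.
HB.instance Definition _ := Group.on congruence_completion.

Lemma congruence_map_compatible (x : profinite_completion G) :
  compatible (fun n => x (stG_fin n)).
Proof. by move=> i j ij; exact: (coordP x (i := stG_fin i) (j := stG_fin j)). Qed.

Definition congruence_map (x : profinite_completion G) : congruence_completion :=
  Completion (congruence_map_compatible x).

Lemma congruence_map_morph : {morph congruence_map : x y / x * y}.
Proof. by move=> x y; apply: completionP. Qed.

Definition congruence_kernel : set (profinite_completion G) :=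
  [set x | congruence_map x = 1].

End CongruenceKernel.

Arguments congruence_kernel {p S} G.

Section GGS.
Variable p : nat.

Definition a_fun (w : word p) : word p :=
  if w is x :: v then ordS x :: v else [::].

(* The letter p is the ordinal of value p - 1. *)
Fixpoint b_fun (w : word p) : word p :=
  if w is x :: v then x :: (if x.+1 == p then b_fun v else a_fun v) else [::].

Let a_inv (w : word p) : word p :=
  if w is x :: v then ord_pred x :: v else [::].

Let b_inv := fix b_inv (w : word p) : word p :=
  if w is x :: v then x :: (if x.+1 == p then b_inv v else a_inv v) else [::].

Let extends (f : word p -> word p) :=
  forall u x, exists y, f (rcons u x) = rcons (f u) y.

Lemma tree_aut_extends f g : cancel f g -> cancel g f ->
  f [::] = [::] -> extends f -> extends g -> tree_aut f.
Proof.
move=> fK gK f0 fe ge.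
have adj_ext h : extends h -> forall u v, adj u v -> adj (h u) (h v).
  by move=> he u v [x [->|->]]; [have [y ->] := he u x | have [y ->] := he v x];
     exists y; [left|right].
split=> // [|u v]; first by exists g.
by split=> [/(adj_ext _ ge)|/(adj_ext _ fe)//]; rewrite !fK.
Qed.

Let a_ext : extends a_fun.
Proof. by move=> [|y u] x /=; [exists (ordS x) | exists x]. Qed.

Let a_inv_ext : extends a_inv.
Proof. by move=> [|y u] x /=; [exists (ord_pred x) | exists x]. Qed.

Lemma a_tree_aut : tree_aut a_fun.
Proof.
apply: (@tree_aut_extends _ a_inv) => //.
- by case=> //= x v; rewrite ordSK.
- by case=> //= x v; rewrite ord_predK.
Qed.

Lemma b_tree_aut : tree_aut b_fun.
Proof.
have aK : cancel a_fun a_inv by case=> //= x v; rewrite ordSK.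
have aVK : cancel a_inv a_fun by case=> //= x v; rewrite ord_predK.
apply: (@tree_aut_extends _ b_inv) => //.
- by move=> w; elim: w => //= x v IH; case: ifP => xp; rewrite xp ?IH ?aK.
- by move=> w; elim: w => //= x v IH; case: ifP => xp; rewrite xp ?IH ?aVK.
- move=> u; elim: u => [|y u IH] x /=; first by exists x; case: ifP.
  by case: ifP => _; [have [z ->] := IH x | have [z ->] := a_ext u x]; exists z.
- move=> u; elim: u => [|y u IH] x; first by exists x => /=; case: ifP.
  rewrite /=; case: ifP => _.
    by have [z zE] := IH x; exists z; rewrite zE.
  by have [z zE] := a_inv_ext u x; exists z; rewrite -/a_inv zE.
Qed.

Definition a_gen : autT p := AutT a_tree_aut.
Definition b_gen : autT p := AutT b_tree_aut.

(* b fixes the first level and psi(b) = (a, ..., a, b). *)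
Lemma b_genE x w :
  b_gen (x :: w) = [:: x] ++ (if x.+1 == p then b_gen else a_gen) w.
Proof. by rewrite /=; case: ifP. Qed.

Definition GGS := gen_group [set a_gen; b_gen].
HB.instance Definition _ := SubGroup.on GGS.

End GGS.

(* Main.v *)
(* Let [z] be a primitive [p]-th root of unity in a finite field [F] of
   characteristic [q <> p].  The point is that [a |-> (x |-> z x)],
   [b |-> (x |-> z x + 1)] extends to a morphism from the GGS-group to the
   affine group of [F].  For a word [w] in [a], [b], the translation part of its
   image is a combination, with powers of [z] as coefficients, of the translation
   parts of the sections of [w] at the first level; if [w] is trivial in the
   group so are its sections, and they have fewer letters [b] unless they are
   powers of [b], so that induction applies.
   Hence, for every prime [q <> p], the group has a finite quotient in which
   [t = b a^-1] has order [q].  On the other hand its congruence quotients are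
   [p]-groups.  So the [q]-primary part of [t] in the profinite completion lies
   in the congruence kernel, and these elements are distinct. *)
Require Import Defs.
From HB Require Import structures.
From mathcomp Require Import all_boot all_fingroup all_algebra all_solvable all_field.
From mathcomp Require Import boolp classical_sets functions cardinality.
From mathcomp Require Import generic_quotient.
(* [generated] and [quotP] are shadowed by the previous imports. *)
Import Defs.

Set Implicit Arguments.
Unset Strict Implicit.
Unset Printing Implicit Defensive.

Import GRing.Theory.
Local Open Scope group_scope.

(** * Words in the generators and their first-level sections *)

Section Words.
Variable p : nat.
Implicit Types (w u : seq bool) (x : 'I_p).

Lemma autT_nil (f : autT p) : f [::] = [::].
Proof. by case: (autTP f). Qed.

(* Words in the generators: [true] stands for [b] and [false] for [a]. *)
Definition letter (l : bool) : autT p := if l then b_gen p else a_gen p.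

Definition eval w : autT p := foldr (fun l f => letter l * f) 1 w.

Lemma eval_cat w u : eval (w ++ u) = eval w * eval u.
Proof. by elim: w => [|l w IH] /=; rewrite ?mul1g // IH mulgA. Qed.

(* Section at the letter [x] of the tree automorphism represented by a word. *)
Fixpoint sec w x : seq bool :=
  if w is l :: u then
    if l then ((iter (count negb u) (@ordS p) x).+1 == p) :: sec u x
    else sec u x
  else [::].

Lemma evalE w x v :
  eval w (x :: v) = iter (count negb w) (@ordS p) x :: eval (sec w x) v.
Proof.
elim: w => [|[] w IH] //; rewrite autT_mulE IH //=.
by case: ifP.
Qed.

Lemma val_iter_ordS n x : iter n (@ordS p) x = (x + n) %% p :> nat.
Proof.
elim: n => [|n IH] /=; first by rewrite addn0 modn_small.
by rewrite IH -addn1 modnDml addn1 addnS.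
Qed.

Lemma iter_ordS_eq n x : (iter n (@ordS p) x == x) = (p %| n).
Proof.
rewrite -val_eqE /= val_iter_ordS -{2}(modn_small (ltn_ord x)).
by rewrite -{2}[x : nat]addn0 eqn_modDl mod0n.
Qed.

Lemma iter_ordS_last n x :
  ((iter n (@ordS p) x).+1 == p) = (p %| (x + n).+1).
Proof.
have p0 : 0 < p by case: (p) x => [[]|].
rewrite val_iter_ordS -addn1 /dvdn -[(x + n).+1]addn1 -[in RHS]modnDml.
have := ltn_pmod (x + n) p0; move: ((x + n) %% p) => m.
rewrite !addn1 leq_eqVlt => /orP[/eqP ->|lt]; first by rewrite modnn !eqxx.
by rewrite modn_small // (ltn_eqF lt).
Qed.

Lemma size_sec w x : size (sec w x) = count id w.
Proof. by elim: w => [|[] w IH] //=; rewrite IH. Qed.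

Lemma sec_nseq_true n x :
  sec (nseq n true) x = nseq n (x.+1 == p).
Proof.
by elim: n => [|n IH] //=; rewrite IH count_nseq mul0n.
Qed.

Lemma eval1_count w (x : 'I_p) : eval w = 1 -> p %| count negb w.
Proof.
by move=> /(congr1 (fun f : autT p => f [:: x])); rewrite evalE => -[/eqP];
  rewrite iter_ordS_eq.
Qed.

Lemma eval1_sec w x : eval w = 1 -> eval (sec w x) = 1.
Proof.
move=> w1; apply: autT_eq => v.
by have := evalE w x v; rewrite w1 => -[_ <-].
Qed.

Lemma eval_nseq_false n : p %| n -> eval (nseq n false) = 1.
Proof.
move=> pn; apply: autT_eq => -[|x v]; first exact: autT_nil.
rewrite evalE count_nseq mul1n; congr (_ :: _).
  by apply/eqP; rewrite iter_ordS_eq.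
by have -> : sec (nseq n false) x = [::] by elim: (n).
Qed.

Lemma eval_nseq_true n : p %| n -> eval (nseq n true) = 1.
Proof.
move=> pn; apply: autT_eq; elim=> [|x v IH]; first exact: autT_nil.
rewrite evalE count_nseq mul0n sec_nseq_true; congr (_ :: _).
by case: eqP => _; rewrite ?IH // eval_nseq_false.
Qed.

Lemma eval_flatten_nseq n w : eval (flatten (nseq n w)) = eval w ^+ n.
Proof. by elim: n => [|n IH] //=; rewrite eval_cat IH expgS. Qed.

(** In a [p]-th power the number of letters [a] is divisible by [p], so it fixes the first level and
    acts below each letter through a section, to which induction applies. *)
Lemma eval_expX n w v : size v = n -> (eval w ^+ (p ^ n)) v = v.
Proof.
elim: n w v => [|n IH] w [|x v] //=.
  by move=> _; exact: autT_nil.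
case=> sv; rewrite expnS expgnA -eval_flatten_nseq.
set W := flatten _.
have cW : iter (count negb W) (@ordS p) x = x.
  apply/eqP; rewrite iter_ordS_eq count_flatten map_nseq sumn_nseq.
  exact: dvdn_mull.
have WE k : (eval W ^+ k) (x :: v) = x :: (eval (sec W x) ^+ k) v.
  elim: k => [|k IHk] //.
  by rewrite !expgS !autT_mulE IHk evalE cW.
by rewrite WE IH.
Qed.

End Words.

(** * The affine action of words *)

Section Affine.
Variables (p : nat) (F : fieldType) (z : F).
Hypothesis zprim : (p.-primitive_root z)%R.
Local Open Scope ring_scope.

Definition aff_letter (l : bool) (x : F) : F := z * x + l%:R.

Definition aff (w : seq bool) (x : F) : F := foldr aff_letter x w.

Lemma aff_cat w u x : aff (w ++ u) x = aff w (aff u x).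
Proof. exact: foldr_cat. Qed.

Lemma affE w x : aff w x = z ^+ size w * x + aff w 0.
Proof.
elim: w => [|l w IH] /=; first by rewrite expr0 mul1r addr0.
by rewrite /aff_letter IH mulrDr mulrA -exprS addrA.
Qed.

Lemma prim_root_subr_neq0 : (1 < p)%N -> 1 - z != 0.
Proof.
move=> p1; rewrite subr_eq0 eq_sym; apply/eqP => z1.
by have := prim_order_dvd zprim 1; rewrite expr1 z1 eqxx dvdn1 gtn_eqF.
Qed.

Lemma sum_powers (n : nat) : (1 < p)%N -> (p %| n)%N -> \sum_(i < n) z ^+ i = 0.
Proof.
move=> p1 pn; apply/(mulfI (prim_root_subr_neq0 p1)).
rewrite mulr0 -opprB mulNr -subrX1.
have /eqP -> : z ^+ n == 1 by rewrite -(prim_order_dvd zprim).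
by rewrite subrr oppr0.
Qed.

Lemma aff_nseq_true n : aff (nseq n true) 0 = \sum_(i < n) z ^+ i.
Proof.
elim: n => [|n IH] /=; first by rewrite big_ord0.
rewrite big_ord_recl expr0 addrC /aff_letter IH mulr_sumr; congr (_ + _).
by apply: eq_bigr => i _; rewrite -exprS.
Qed.

Lemma aff_nseq_false n : aff (nseq n false) 0 = 0.
Proof. by elim: n => //= n ->; rewrite /aff_letter mulr0 addr0. Qed.

Lemma aff_nseq_p l x : (1 < p)%N -> aff (nseq p l) x = x.
Proof.
move=> p1; rewrite affE size_nseq (prim_expr_order zprim) mul1r.
by case: l; rewrite ?aff_nseq_false ?addr0 // aff_nseq_true sum_powers ?addr0.
Qed.

(** Prepending [a] multiplies both sides by [z]. Prepending [b] does so too and adds 1, which on the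
    right comes from the only section that receives a letter [b]: its coefficient is 1, the exponent
    of [z] being a multiple of [p]. *)
Lemma aff0_sec w : (0 < p)%N ->
  aff w 0 = \sum_(x < p) z ^+ (count negb w + x).+1 * aff (sec w x) 0.
Proof.
move=> p0; elim: w => [|[] w IH] /=.
- by rewrite big1 // => x _; rewrite mulr0.
- rewrite add0n /aff_letter IH mulr_sumr.
  under [RHS]eq_bigr do rewrite mulrDr mulrCA iter_ordS_last.
  rewrite big_split /=; congr (_ + _).
  have [x px] : exists x : 'I_p, (p %| (x + count negb w).+1)%N.
    pose m := (count negb w).+1.
    (* The residue of [-m] modulo [p]. *)
    pose y := Ordinal (ltn_pmod (p - m %% p) p0); exists y.
    rewrite -addnS -/m /dvdn /= modnDml -modnDmr subnK ?modnn //.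
    by rewrite ltnW // ltn_pmod.
  rewrite (bigD1 x) //= px mulr1 (addnC (count negb w) x).
  have /eqP -> : z ^+ (x + count negb w).+1 == 1 by rewrite -(prim_order_dvd zprim).
  rewrite big1 ?addr0 // => y yx; case py: (p %| _)%N; last by rewrite mulr0.
  case/negP: yx; rewrite -val_eqE /= -(modn_small (ltn_ord x)) -(modn_small (ltn_ord y)).
  rewrite -(eqn_modDr (count negb w).+1) !addnS.
  by move: px py; rewrite /dvdn => /eqP -> /eqP ->.
- rewrite /aff_letter addr0 IH mulr_sumr; apply: eq_bigr => x _.
  by rewrite mulrA -exprS.
Qed.

(** At a letter other than the last, the section of [b ^ n] is [a ^ n]. *)
Lemma eval_nseq_true1 n : (1 < p)%N -> eval p (nseq n true) = 1%g -> (p %| n)%N.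
Proof.
move=> p1 /(eval1_sec (Ordinal (ltnW p1))); rewrite sec_nseq_true /= (ltn_eqF p1).
move=> /(eval1_count (Ordinal (ltnW p1))).
by rewrite count_nseq mul1n.
Qed.

(** The count of letters [b] is carried along because [eval1_aff] needs it for the linear part. *)
Lemma eval1_aff_count w : (1 < p)%N -> eval p w = 1%g ->
  (p %| count id w)%N /\ aff w 0 = 0.
Proof.
move=> p1; have [n] := ubnP (count id w); elim: n w => // n IHn w le w1.
have p0 := ltnW p1; pose x0 := Ordinal p0.
have IH (x : 'I_p) : (p %| count id (sec w x))%N /\ aff (sec w x) 0 = 0.
  have := count_size id (sec w x); rewrite leq_eqVlt => /orP[|lt]; last first.
    apply: IHn; last exact: eval1_sec.
    by rewrite (leq_trans lt) // size_sec -ltnS.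
  (* The remaining case is a power of [b]: its exponent is a multiple of [p], so its translation
     part is a vanishing geometric sum. *)
  rewrite -all_count (@eq_all _ _ (pred1 true)) => [/all_pred1P secE|[]//].
  have := eval1_sec x w1; rewrite secE => /(eval_nseq_true1 p1) pn.
  by rewrite count_nseq mul1n aff_nseq_true sum_powers.
split.
  (* The letters [b] of [w] correspond to the letters of a section, where both generators occur a
     multiple of [p] times. *)
  rewrite -(size_sec w x0) -(count_predC id).
  by rewrite dvdn_add ?(IH _).1 //; exact/(eval1_count x0)/eval1_sec.
by rewrite aff0_sec // big1 // => x _; rewrite (IH x).2 mulr0.
Qed.

Lemma eval1_aff w x : (1 < p)%N -> eval p w = 1%g -> aff w x = x.
Proof.
move=> p1 w1; have [pB w0] := eval1_aff_count p1 w1.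
rewrite affE w0 addr0 -(count_predC id).
have /eqP -> : z ^+ (count id w + count negb w) == 1.
  rewrite -(prim_order_dvd zprim) dvdn_add //.
  exact: (eval1_count (Ordinal (ltnW p1))).
by rewrite mul1r.
Qed.

(** Both generators have trivial [p]-th power, so positive words suffice for inverses. *)
Fixpoint inv_word (w : seq bool) : seq bool :=
  if w is l :: u then inv_word u ++ nseq p.-1 l else [::].

Lemma eval_nseq_p l : eval p (nseq p l) = 1%g.
Proof. by case: l; rewrite ?eval_nseq_true ?eval_nseq_false. Qed.

Lemma eval_inv_word w : (0 < p)%N -> eval p (inv_word w) = (eval p w)^-1%g.
Proof.
move=> p0; elim: w => [|l w IH] /=; first by rewrite invg1.
rewrite eval_cat IH invgM; congr (_ * _)%g.
have nseqE : nseq p l = l :: nseq p.-1 l by rewrite -{1}(prednK p0).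
by rewrite -[RHS]mulg1 -(eval_nseq_p l) nseqE /= mulKg.
Qed.

Lemma aff_inv_wordK w : (1 < p)%N -> cancel (aff w) (aff (inv_word w)).
Proof.
move=> p1; elim: w => [|l w IH] x //=.
rewrite aff_cat -[aff_letter l _]/(aff (nseq 1 l) (aff w x)).
rewrite -(aff_cat (nseq p.-1 l)) -nseqD addn1 (prednK (ltnW p1)).
by rewrite aff_nseq_p // IH.
Qed.

Lemma aff_inj w : (1 < p)%N -> injective (aff w).
Proof. by move=> p1; exact: can_inj (aff_inv_wordK w p1). Qed.

(** The word for [w^-1 u] is trivial, so the affine map depends only on the group element. *)
Lemma eval_eq_aff w u : (1 < p)%N -> eval p w = eval p u -> aff w =1 aff u.
Proof.
move=> p1 wu x; apply: (aff_inj p1 (w := inv_word w)).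
rewrite aff_inv_wordK // -aff_cat eval1_aff //.
by rewrite eval_cat -wu eval_inv_word ?mulVg // ltnW.
Qed.

End Affine.

Local Open Scope classical_set_scope.

(** * Exponents projecting onto primary components *)

Section PrimaryPart.

(* Exponent whose power map is the projection of a cyclic group of order [m]
   onto its [q]-primary component. *)
Definition primary_exp q m := chinese m`_q m`_q^' 1 0.

Lemma coprime_parts q m : coprime m`_q m`_q^'.
Proof. by rewrite (@pnat_coprime q) ?part_pnat. Qed.

(** The [q]-part and the [q']-part of [m] divide those of [m * n], so the congruences defining the
    exponent for [m * n] imply those for [m]. *)
Lemma primary_expM q m n : 0 < m -> 0 < n ->
  primary_exp q (m * n) = primary_exp q m %[mod m].
Proof.
move=> m0 n0; apply/eqP; rewrite -[X in _ == _ %[mod X]](partnC q m0).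
rewrite chinese_remainder ?coprime_parts //.
rewrite /primary_exp !chinese_modl ?chinese_modr ?coprime_parts //.
have dvd_part pi : m`_pi %| (m * n)`_pi by rewrite partnM // dvdn_mulr.
rewrite -(modn_dvdm _ (dvd_part q)) -(modn_dvdm _ (dvd_part q^')).
by rewrite chinese_modl ?chinese_modr ?coprime_parts // !modn_dvdm // !eqxx.
Qed.

Lemma primary_exp_pnat q m : q.-nat m -> primary_exp q m = 1 %[mod m].
Proof.
move=> qm; rewrite -{2 3}(part_pnat_id qm).
by rewrite chinese_modl ?coprime_parts.
Qed.

Lemma primary_exp_p'nat q m : q^'.-nat m -> primary_exp q m = 0 %[mod m].
Proof.
move=> qm; rewrite -{2 3}(part_pnat_id qm).
by rewrite chinese_modr ?coprime_parts.
Qed.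

Variables (H : groupType) (y : H).

Lemma eq_expg_mod m i j : y ^+ m = 1 -> i = j %[mod m] -> y ^+ i = y ^+ j.
Proof.
move=> ym ij; rewrite (divn_eq i m) (divn_eq j m) ij !expgnDr.
by rewrite mulnC expgnA ym expg1n mulnC expgnA ym expg1n.
Qed.

(** Both powers agree with the one obtained from [m * n]. *)
Lemma expg_primary_exp q m n : 0 < m -> 0 < n -> y ^+ m = 1 -> y ^+ n = 1 ->
  y ^+ primary_exp q m = y ^+ primary_exp q n.
Proof.
move=> m0 n0 ym yn; rewrite -(eq_expg_mod ym (primary_expM q m0 n0)).
by rewrite mulnC (eq_expg_mod yn (primary_expM q n0 m0)).
Qed.

End PrimaryPart.

Local Open Scope quotient_scope.

(** * The primary part of an element in the profinite completion *)

Section PrimaryElement.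
Variables (G : groupType) (g : G) (q : nat).

Lemma quot_piX (N : normalSubgroup G) (x : G) n :
  \pi_(quot N) (x ^+ n) = (\pi_(quot N) x) ^+ n.
Proof. by elim: n => [|n IH] //; rewrite !expgS quot_piM IH. Qed.

Lemma finite_expg1 (H : groupType) (y : H) : finite_set [set: H] ->
  exists n, 0 < n /\ y ^+ n = 1.
Proof.
move=> Hfin; apply: contrapT => noexp.
have inj_exp : injective (fun n => y ^+ n).
  suff le i j : i <= j -> y ^+ i = y ^+ j -> i = j.
    by move=> i j; case: (leqP i j) => [|/ltnW] ij yij;
      [exact: le | apply/esym/le].
  rewrite leq_eqVlt => /orP[/eqP//|ij] yij; case: noexp; exists (j - i).
  by rewrite subn_gt0 ij expgnFr 1?ltnW // yij mulgV.
apply: infinite_nat; rewrite -(preimage_setT (fun n => y ^+ n)).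
by apply: finite_preimage => // ? ? _ _; exact: inj_exp.
Qed.

Lemma finite_index_expg (N : finiteIndexNormal G) :
  exists n, 0 < n /\ (\pi_(quot N) g) ^+ n = 1.
Proof. exact/finite_expg1/finsgP. Qed.

(** An arbitrary choice; by [primary_coordE] the coordinate does not depend on it. *)
Definition coord_exp (N : finiteIndexNormal G) : nat :=
  projT1 (cid (finite_index_expg N)).

Definition primary_coord (N : finiteIndexNormal G) : quot N :=
  (\pi_(quot N) g) ^+ primary_exp q (coord_exp N).

Lemma primary_coordE (N : finiteIndexNormal G) n : 0 < n ->
  (\pi_(quot N) g) ^+ n = 1 ->
  primary_coord N = (\pi_(quot N) g) ^+ primary_exp q n.
Proof.
move=> n0 gn; rewrite /primary_coord /coord_exp.
by case: cid => m [m0 gm] /=; exact: expg_primary_exp.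
Qed.

Lemma primary_coord_compatible : compatible primary_coord.
Proof.
move=> N M NM; rewrite /primary_coord {1}/coord_exp.
case: cid => m [m0 gm] /=.
(* An exponent killing [g] modulo [N] also kills it modulo [M], so it computes both coordinates. *)
rewrite -quot_piX quot_mapE // quot_piX; apply/esym/primary_coordE => //.
by rewrite -quot_piX -(quot_mapE _ NM) quot_piX gm -quot_pi1 quot_mapE.
Qed.

Definition primary_element : profinite_completion G :=
  Completion primary_coord_compatible.

End PrimaryElement.

(** * Finite affine quotients of the GGS-group *)

Section Subgroups.
Variable p : nat.
Hypothesis p1 : 1 < p.

Lemma evalP (g : GGS p) : exists w, eval p w = \val g.
Proof.
have /asboolP gen := valP g.
have /asboolP// : \val g \in [pred f | `[< exists w, eval p w = f >]].
apply: gen => [|f [->|->]]; last 2 first.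
- by apply/asboolP; exists [:: false]; rewrite /= mulg1.
- by apply/asboolP; exists [:: true]; rewrite /= mulg1.
split=> [|f h /asboolP[w <-] /asboolP[u <-]]; apply/asboolP; first by exists [::].
by exists (w ++ inv_word p u); rewrite eval_cat eval_inv_word // ltnW.
Qed.

Lemma val_expg (g : GGS p) f n : \val g = f -> \val (g ^+ n) = f ^+ n.
Proof. by move=> <-; exact: gmulfXn. Qed.

Lemma eval_GGS w : exists g : GGS p, \val g = eval p w.
Proof.
have letterP l : letter p l \in generated [set a_gen p; b_gen p].
  by apply/asboolP => S _; apply; case: l; [right | left].
elim: w => [|l w [g gE]]; first by exists 1; rewrite val1.
pose h : GGS p := exist _ (letter p l) (letterP l).
by exists (h * g); rewrite gmulfM; congr (_ * _).
Qed.

Variables (F : finFieldType) (z : F).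
Hypothesis zprim : (p.-primitive_root z)%R.

(** One word is enough: by [eval_eq_aff] all words for [g] induce the same map. *)
Definition aff_kernel_set (g : GGS p) : Prop :=
  exists2 w, eval p w = \val g & aff z w =1 id.

Lemma aff_kernel1 : aff_kernel_set 1.
Proof. by exists [::]; rewrite ?val1. Qed.

Lemma aff_kernelF x y :
  aff_kernel_set x -> aff_kernel_set y -> aff_kernel_set (x * y^-1).
Proof.
move=> [w wx w1] [u uy u1]; exists (w ++ inv_word p u) => [|t].
  by rewrite gmulfF eval_cat eval_inv_word ?(ltnW p1) // wx uy.
by rewrite aff_cat w1 -{1}[t]u1 (aff_inv_wordK zprim).
Qed.

Lemma aff_kernelJ x y : aff_kernel_set x -> aff_kernel_set (x ^ y).
Proof.
move=> [w wx w1]; have [u uy] := evalP y.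
exists (inv_word p u ++ w ++ u) => [|t].
  by rewrite gmulfJ conjgE !eval_cat eval_inv_word ?(ltnW p1) // wx uy.
by rewrite !aff_cat w1 (aff_inv_wordK zprim).
Qed.

Definition aff_kernel :=
  NormalSubgroup aff_kernel1 aff_kernelF aff_kernelJ.

(** A coset is determined by the affine map of a representative, and [F] has finitely many
    self-maps. *)
Lemma aff_kernel_finite_index : finite_index aff_kernel.
Proof.
pose wd g := projT1 (cid (evalP g)).
have wdE g : eval p (wd g) = \val g by rewrite /wd; case: cid.
pose f (x : quot aff_kernel) := [ffun t => aff z (wd (repr x)) t].
have f_inj : injective f.
  move=> x y /ffunP fxy; rewrite -[x]reprK -[y]reprK; apply/quotP.
  exists (inv_word p (wd (repr x)) ++ wd (repr y)) => [|t].
    by rewrite eval_cat eval_inv_word ?(ltnW p1) // !wdE gmulfM gmulfV.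
  by rewrite aff_cat; move: (fxy t); rewrite !ffunE => <-; rewrite (aff_inv_wordK zprim).
rewrite /finite_index -(preimage_setT f); apply: finite_preimage.
  exact: in2W.
exact: finite_finset.
Qed.

Definition aff_kernel_fin := FiniteIndexNormal aff_kernel_finite_index.

(** A positive word for [t = b a^-1], which acts on [F] as translation by 1. *)
Definition transl_word := true :: nseq p.-1 false.

Lemma aff_transl_wordX n x :
  aff z (flatten (nseq n transl_word)) x = (x + n%:R)%R.
Proof.
elim: n => [|n IH] /=; first by rewrite addr0.
rewrite aff_cat IH /aff_letter affE size_nseq aff_nseq_false addr0 mulrA.
rewrite -exprS prednK ?(ltnW p1) // (prim_expr_order zprim) mul1r.
by rewrite -addrA -mulrSr.
Qed.

Lemma aff_kernel_translX (t : GGS p) n : \val t = eval p transl_word ->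
  aff_kernel (t ^+ n) <-> (n%:R = 0 :> F)%R.
Proof.
move=> tE; have tnE : eval p (flatten (nseq n transl_word)) = \val (t ^+ n).
  by rewrite eval_flatten_nseq (val_expg _ tE).
split=> [[w wE w1]|n0]; last first.
  by exists (flatten (nseq n transl_word)) => // x; rewrite aff_transl_wordX n0 addr0.
have := aff_transl_wordX n 0%R; rewrite add0r => <-.
by rewrite -(eval_eq_aff zprim p1 (w := w)) // wE tnE.
Qed.

End Subgroups.

(** * Roots of unity in finite fields *)

Lemma finite_field_prim_root p q : prime p -> prime q -> q != p ->
  exists F : finFieldType,
    q \in [pchar F]%R /\ exists z : F, (p.-primitive_root z)%R.
Proof.
move=> p_pr q_pr qp.
have p_gt1 := prime_gt1 p_pr.
have p'_gt0 : 0 < p.-1 by rewrite -subn1 subn_gt0.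
(* In the field with [q ^ p.-1] elements, [p] divides the order of the unit group by Fermat, and
   Cauchy gives a unit of order [p]. *)
have [F Fchar Fcard] := pPrimePowerField q_pr p'_gt0.
exists F; split=> //.
have [] := @Cauchy _ p [set: {unit F}]%G p_pr.
  rewrite card_finField_unit Fcard -subn1.
  rewrite -eqn_mod_dvd ?expn_gt0 ?prime_gt0 //.
  rewrite -(totient_prime p_pr) Euler_exp_totient //.
  by rewrite coprime_sym prime_coprime // dvdn_prime2 // eq_sym.
move=> u _ uo; exists (val u).
have up : ((val u) ^+ p)%R = 1%R by rewrite -FinRing.val_unitX -uo expg_order.
have [m um] := prim_order_exists (prime_gt0 p_pr) up.
case/primeP: (p_pr) => _ /[apply] /orP[]/eqP mE; last by rewrite -mE.
have := prim_expr_order um; rewrite mE expr1 => u1.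
have /eqP : u = 1%g by apply: val_inj.
by rewrite -order_eq1 uo gtn_eqF.
Qed.

(** * Infinitely many elements of the congruence kernel *)

Theorem theoremB (p : nat) (p_prime : prime p) (p_odd : odd p) :
  infinite_set (congruence_kernel (GGS p)).
Proof.
have p1 := prime_gt1 p_prime.
have [t tE] := eval_GGS p (transl_word p).
have in_kernel q : prime q -> q != p ->
    congruence_kernel (GGS p) (primary_element t q).
  move=> q_pr qp; apply: completionP => n /=.
  (* At level [n] the exponent [p ^ n] kills [t] and is prime to [q], so the [q]-primary exponent is
     0 there. *)
  have tpn : (\pi_(quot (stG (GGS p) n)) t) ^+ (p ^ n) = 1.
    rewrite -quot_piX -quot_pi1; apply/esym/quotP => v vn.
    rewrite invg1 mul1g.
    by rewrite (val_expg _ tE) eval_expX.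
  have pn0 : (0 < p ^ n)%N by rewrite expn_gt0 ltnW.
  rewrite (primary_coordE q pn0 (N := stG_fin (GGS p) n) tpn).
  have p'q : q^'.-nat (p ^ n)%N.
    by rewrite pnatX pnatE // !inE eq_sym qp.
  exact: eq_expg_mod tpn (primary_exp_p'nat p'q).
have inj q r : prime q -> prime r -> q != p -> r != q ->
    primary_element t q <> primary_element t r.
  move=> q_pr r_pr qp rq.
  have [F [Fq [z zprim]]] := finite_field_prim_root p_prime q_pr qp.
  move/(congr1 (fun x : profinite_completion _ => x (aff_kernel_fin p1 zprim))) => /=.
  (* In the affine quotient of characteristic [q], the [q]-part of [t] is [t] itself and its
     [r]-part is 1. *)
  have tq : (\pi_(quot (aff_kernel p1 zprim)) t) ^+ q = 1.
    rewrite -quot_piX -quot_pi1; apply/esym/quotP; rewrite invg1 mul1g.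
    by apply/(aff_kernel_translX p1 zprim q tE); exact: pcharf0.
  have q0 := prime_gt0 q_pr.
  rewrite !(primary_coordE _ q0 (N := aff_kernel_fin p1 zprim) tq).
  rewrite (eq_expg_mod tq (primary_exp_pnat (pnat_id q_pr))).
  have r'q : r^'.-nat q by rewrite pnatE // !inE eq_sym.
  rewrite (eq_expg_mod tq (primary_exp_p'nat r'q)) -!quot_piX.
  move=> /esym/quotP; rewrite expg0 invg1 mul1g.
  (* Equality would put [t] in the affine kernel, forcing 1 = 0 in [F]. *)
  move=> /(aff_kernel_translX p1 zprim 1 tE)/eqP.
  by rewrite oner_eq0.
pose A := [set q | prime q && (q != p)].
have A_inj : {in A &, injective (primary_element t)}.
  move=> q r /[!inE] /andP[q_pr qp] /andP[r_pr rp] qr.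
  by apply/eqP/negPn/negP => neq; apply: (inj q r) => //; rewrite eq_sym.
move=> Kfin; have /finite_seqP[s sE] : finite_set A.
  rewrite -(eq_finite_set (inj_card_eq A_inj)).
  by apply: sub_finite_set Kfin => _ [q /andP[q_pr qp] <-]; exact: in_kernel.
(* A prime beyond [p] and every member of the finite list lies in [A], a contradiction. *)
have [q qs q_pr] := prime_above (maxn p (\max_(i <- s) i)).
have : A q by rewrite /A /= q_pr gtn_eqF // (leq_ltn_trans (leq_maxl _ _) qs).
rewrite sE /= => sq; move: qs; rewrite ltnNge (leq_trans _ (leq_maxr _ _)) //.
exact: leq_bigmax_seq.
Qed.
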